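(* Suppose that the sets of optimal solutions of $(\mathcal{P}_R)$ and of $(\mathcal{D}_R)$ are both nonempty and that the feasible set of $(\mathcal{P}_R)$ is bounded. Let $P\in\mathbb{S}^n$ be a nonzero matrix, and let $\{\varepsilon_t\}_{t=1}^\infty$ be a monotonically decreasing sequence of positive numbers with $\lim_{t\to\infty}\varepsilon_t=0$. If the SDP relaxation of the $\varepsilon_t$-perturbed problem $(\mathcal{P}^{\varepsilon_t})$ is exact for all $t=1,2,\dots$, then the SDP relaxation of the original problem $(\mathcal{P})$ is also exact.
   Context: Let $\mathbb{S}^n$ be the space of real symmetric $n\times n$ matrices, $[m]=\{1,\dots,m\}$, and $A\bullet B=\sum_{i,j}A_{ij}B_{ij}$. Let $Q^0,\dots,Q^m\in\mathbb{S}^n$ and $b\in\mathbb{R}^m$. Consider the QCQP $(\mathcal{P})$: minimize $x^TQ^0x$ over $x\in\mathbb{R}^n$ subject to $x^TQ^px\le b_p$ for $p\in[m]$. Throughout, $(\mathcal{P})$ is assumed to be feasible. Its SDP relaxation $(\mathcal{P}_R)$ is: minimize $Q^0\bullet X$ over $X\in\mathbb{S}^n$ subject to $Q^p\bullet X\le b_p$ for $p\in[m]$, $X\succeq O$ (positive semidefinite). The dual $(\mathcal{D}_R)$ is: maximize $-b^Ty$ over $y\in\mathbb{R}^m$ subject to $y\ge 0$ and $S(y):=Q^0+\sum_{p=1}^m y_pQ^p\succeq O$. The SDP relaxation of a QCQP is called exact if it has an optimal solution of rank at most $1$. For $\varepsilon>0$, the $\varepsilon$-perturbed problem $(\mathcal{P}^\varepsilon)$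 is the QCQP obtained from $(\mathcal{P})$ by replacing $Q^0$ with $Q^0+\varepsilon P$ and keeping all constraints; its SDP relaxation is formed in the same way. *)

(* Defs.v *)
From HB Require Import structures.
From mathcomp Require Export all_boot all_order all_algebra.
From mathcomp Require Export all_classical all_reals all_analysis.
Export Order.TTheory GRing.Theory Num.Theory.
Export numFieldNormedType.Exports.

Set Implicit Arguments.
Unset Strict Implicit.
Unset Printing Implicit Defensive.

Local Open Scope classical_set_scope.
Local Open Scope ring_scope.

Section Optimization.
Context {R : realType} {T : Type}.

Definition minimizers (D : set T) (f : T -> R) : set T :=
  [set x | D x /\ forall z, D z -> f x <= f z].

Definition maximizers (D : set T) (f : T -> R) : set T :=
  [set x | D x /\ forall z, D z -> f z <= f x].

End Optimization.

Section QCQP.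
Context {R : realType} {n m : nat}.

Definition quadform (A : 'M[R]_n) (x : 'cV[R]_n) : R := (x^T *m A *m x) 0 0.

Definition mxinner (A B : 'M[R]_n) : R := \sum_i \sum_j A i j * B i j.

Definition psdmx (A : 'M[R]_n) : Prop :=
  A \is symmetricmx /\ forall x : 'cV[R]_n, 0 <= quadform A x.

Variables (Q0 : 'M[R]_n) (Q : 'I_m -> 'M[R]_n) (b : 'cV[R]_m).

Definition qcqp_feasible : set 'cV[R]_n :=
  [set x | forall p, quadform (Q p) x <= b p 0].

Definition sdp_feasible : set 'M[R]_n :=
  [set X | psdmx X /\ forall p, mxinner (Q p) X <= b p 0].

Definition sdp_optimal : set 'M[R]_n := minimizers sdp_feasible (mxinner Q0).

Definition dual_slack (y : 'cV[R]_m) : 'M[R]_n := Q0 + \sum_p y p 0 *: Q p.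

Definition dual_feasible : set 'cV[R]_m :=
  [set y : 'cV[R]_m | (forall p, 0 <= y p 0) /\ psdmx (dual_slack y)].

Definition dual_optimal : set 'cV[R]_m :=
  maximizers dual_feasible (fun y : 'cV[R]_m => - (b^T *m y) 0 0).

Definition sdp_exact : Prop :=
  exists2 X, sdp_optimal X & (\rank X <= 1)%N.

End QCQP.

(* Main.v *)
(* The rank-at-most-1 part of the feasible set is cut out by the vanishing of the
   2x2 minors, hence compact, so Q0 attains its minimum on it at some X. Let Z be
   feasible, and let X_t be a rank-at-most-1 solution of the t-th perturbed
   relaxation. Then
     Q0.X <= Q0.X_t <= Q0.Z + eps_t (P.Z - P.X_t) <= Q0.Z + eps_t (P.Z - min P),
   the minimum of P being over the feasible set, and eps_t -> 0 gives
   Q0.X <= Q0.Z. *)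
From mathcomp Require Import lra.
Require Import Defs.

Local Open Scope classical_set_scope.
Local Open Scope ring_scope.

(** Rank at most 1 means being an outer product. The minors restate this as polynomial equations in
    the entries, the form from which closedness follows. *)
Lemma rank_le1P {F : fieldType} {p q : nat} (X : 'M[F]_(p, q)) :
  (\rank X <= 1)%N <->
  forall i j k l, X i j * X k l = X i l * X k j.
Proof.
split=> [rX i j k l|minors].
  have [u [v ->]] : exists (u : 'cV_p) (v : 'rV_q), X = u *m v.
    (* The rank factorization of [X] has inner dimension [\rank X]. Dimension 1 gives [u] and [v]
       directly; in dimension 0 the product is an empty sum, so [X] is 0. *)
    case: (\rank X) (col_base X) (row_base X) (mulmx_base X) rX
      => [|[|r]] // U V <- _.
      by exists 0, 0; rewrite mul0mx; apply/matrixP => ? ?; rewrite !mxE big_ord0.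
    by exists U, V.
  by rewrite !mxE !big_ord1 mulrACA [RHS]mulrACA; congr (_ * _); exact: mulrC.
have [->|/eqP X0] := eqVneq X 0; first by rewrite mxrank0.
have [k [l Xkl]] : exists k l, X k l != 0.
  apply: contrapT => nex; apply: X0; apply/matrixP => k l; rewrite mxE.
  by apply/eqP; apply: contrapT => /negP Xkl; apply: nex; exists k, l.
(* With the pivot [X k l], the minors through row [k] and column [l] make [X] the outer product of
   that column and that row, divided by the pivot. *)
rewrite (_ : X = (\col_i X i l) *m (\row_j (X k j / X k l))).
  exact: mulmx_max_rank.
apply/matrixP => i j; rewrite !mxE big_ord1 !mxE mulrA -minors.
by rewrite mulfK.
Qed.

Section MatrixTopology.
Context {R : realType}.

(** Balls are defined entrywise and [vec_mx] only reindexes entries, so the same radius works. *)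
Lemma vec_mx_continuous {p q : nat} :
  continuous (fun v : 'rV[R]_(p * q) => vec_mx v : 'M[R]_(p, q)).
Proof.
move=> v s /= /(nbhs_ballP (vec_mx v : 'M[R]_(p, q))) [e e0 es].
apply/nbhs_ballP; exists e => //= w [_ vw]; apply: es; split => // i j.
by rewrite !mxE; exact: vw.
Qed.

Lemma norm_le_vec_mx {p q : nat} (v : 'rV[R]_(p * q)) :
  `|v| <= `|(vec_mx v : 'M[R]_(p, q))|.
Proof.
rewrite [leLHS]/Num.norm [leRHS]/Num.norm /= !mx_normrE.
apply/bigmax_leP; split => [|[i k] _ /=].
  by apply: bigmax_ge_id.
rewrite ord1; case/mxvec_indexP: k => j k.
have -> : v 0 (mxvec_index j k) = (vec_mx v : 'M[R]_(p, q)) j k by rewrite mxE.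
by apply/bigmax_geP; right => /=; exists (j, k).
Qed.

(** Heine-Borel for row vectors is carried over to matrices: [A] is the image under the continuous
    surjection [vec_mx] of its preimage, which is closed, and bounded by [norm_le_vec_mx]. *)
Lemma mx_bounded_closed_compact {p q : nat} (A : set 'M[R]_(p, q)) :
  bounded_set A -> closed A -> compact A.
Proof.
move=> [M [Mreal AM]] Acl.
rewrite -(_ : vec_mx @` (vec_mx @^-1` A) = A); last first.
  apply/image_preimage/seteqP; split => // B _.
  by exists (mxvec B) => //; rewrite mxvecK.
apply: continuous_compact.
  exact/continuous_subspaceT/vec_mx_continuous.
apply: bounded_closed_compact.
  exists M; split => // N MN v Av.
  exact: le_trans (norm_le_vec_mx v) (AM _ MN _ Av).
by apply: preimage_closed => // v _; exact: vec_mx_continuous.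
Qed.

Lemma closed_fun_le {T : topologicalType} (f : T -> R) (c : R) :
  continuous f -> closed [set x | f x <= c].
Proof.
by move=> fc; apply: (@preimage_closed _ _ f [set y | y <= c]) => //.
Qed.

Lemma closed_fun_eq {T : topologicalType} (f g : T -> R) :
  continuous f -> continuous g -> closed [set x | f x = g x].
Proof.
move=> fc gc.
rewrite (_ : mkset _ = (f \- g) @^-1` [set y | y = 0]); last first.
  apply/seteqP; split => x /= fg; first by rewrite fg subrr.
  exact: subr0_eq fg.
apply: preimage_closed; last exact: closed_eq.
by move=> x _; apply: cvgB; [exact: fc | exact: gc].
Qed.

Lemma rank_le1_closed {p q : nat} :
  closed [set X : 'M[R]_(p, q) | (\rank X <= 1)%N].
Proof.
rewrite (_ : mkset _ = \bigcap_i \bigcap_j \bigcap_k \bigcap_l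
    [set X : 'M[R]_(p, q) | X i j * X k l = X i l * X k j]).
  do 4 (apply: closed_bigI => ? _).
  by apply: closed_fun_eq => X; apply: continuousM; exact: coord_continuous.
apply/seteqP; split => X /= => [/rank_le1P minors i _ j _ k _ l _|minors].
  exact: minors.
by apply/rank_le1P => i j k l; exact: minors.
Qed.

End MatrixTopology.

Section SDP.
Context {R : realType} {n m : nat}.
Implicit Types A B X : 'M[R]_n.

Lemma mxinner_continuous A : continuous (mxinner A).
Proof.
apply: continuous_big => [|i _]; first exact: add_continuous.
apply: continuous_big => [|j _]; first exact: add_continuous.
by move=> X; apply: continuousM; [exact: cst_continuous | exact: coord_continuous].
Qed.

Lemma mxinnerDl A B X : mxinner (A + B) X = mxinner A X + mxinner B X.
Proof.
rewrite -big_split; apply: eq_bigr => i _; rewrite -big_split.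
by apply: eq_bigr => j _; rewrite mxE mulrDl.
Qed.

Lemma mxinnerZl (c : R) A X : mxinner (c *: A) X = c * mxinner A X.
Proof.
rewrite mulr_sumr; apply: eq_bigr => i _; rewrite mulr_sumr.
by apply: eq_bigr => j _; rewrite mxE mulrA.
Qed.

(** For fixed [x] this exhibits the quadratic form as a linear, hence continuous, function of
    [X]. *)
Lemma quadform_mxinner X (x : 'cV[R]_n) : quadform X x = mxinner (x *m x^T) X.
Proof.
rewrite /quadform /mxinner mxE exchange_big; apply: eq_bigr => j _.
rewrite !mxE mulr_suml; apply: eq_bigr => i _.
by rewrite !mxE big_ord1 !mxE mulrAC.
Qed.

Lemma symmetricmxP {X} : X \is symmetricmx <-> forall i j, X i j = X j i.
Proof.
(* [symmetricmx] is a case of the hermitian predicate, whose sign factor has exponent 0 here. *)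
rewrite is_hermitianmxE expr0 scale1r; split=> [/eqP/matrixP XT i j|XT].
  by rewrite {1}XT !mxE.
by apply/eqP/matrixP => i j; rewrite !mxE.
Qed.

Lemma psdmx_closed : closed [set X : 'M[R]_n | psdmx X].
Proof.
(* The cone is an intersection of linear equations and half-spaces, one for each vector [x]. The
   minus sign turns positivity into an upper bound, as [closed_fun_le] requires. *)
rewrite (_ : mkset _ =
    (\bigcap_i \bigcap_j [set X : 'M[R]_n | X i j = X j i]) `&`
    (\bigcap_(x in [set: 'cV[R]_n]) [set X | mxinner (- (x *m x^T)) X <= 0])).
  apply: closedI.
    apply: closed_bigI => i _; apply: closed_bigI => j _.
    by apply: closed_fun_eq; exact: coord_continuous.
  by apply: closed_bigI => x _; apply: closed_fun_le; exact: mxinner_continuous.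
have psdE X x : (mxinner (- (x *m x^T)) X <= 0) = (0 <= quadform X x).
  by rewrite -scaleN1r mxinnerZl mulN1r oppr_le0 quadform_mxinner.
apply/seteqP; split => X /=.
  move=> [/symmetricmxP Xsym Xpos]; split=> [i _ j _|x _] //=.
  by rewrite psdE.
move=> [Xsym Xpos]; split; first by apply/symmetricmxP => i j; exact: Xsym.
by move=> x; rewrite -psdE; exact: Xpos.
Qed.

Lemma sdp_feasible_closed (Q : 'I_m -> 'M[R]_n) (b : 'cV[R]_m) :
  closed (sdp_feasible Q b).
Proof.
rewrite (_ : sdp_feasible Q b = [set X | psdmx X] `&`
    \bigcap_p [set X | mxinner (Q p) X <= b p 0]).
  apply: closedI; first exact: psdmx_closed.
  by apply: closed_bigI => p _; apply: closed_fun_le; exact: mxinner_continuous.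
by apply/seteqP; split => X [Xpsd Xb]; split => // p; [move=> _|]; exact: Xb.
Qed.

End SDP.

Theorem lemma4p2 (R : realType) (n m : nat)
    (Q0 : 'M[R]_n) (Q : 'I_m -> 'M[R]_n) (b : 'cV[R]_m)
    (Q0_sym : Q0 \is symmetricmx) (Q_sym : forall p, Q p \is symmetricmx)
    (qcqp_feas : qcqp_feasible Q b !=set0)
    (primal_opt : sdp_optimal Q0 Q b !=set0)
    (dual_opt : dual_optimal Q0 Q b !=set0)
    (feas_bounded : bounded_set (sdp_feasible Q b))
    (P : 'M[R]_n) (P_sym : P \is symmetricmx) (P_neq0 : P != 0)
    (eps : R^nat) (eps_gt0 : forall t, 0 < eps t)
    (eps_decr : nonincreasing_seq eps)
    (eps_cvg0 : eps @ \oo --> 0)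
    (eps_exact : forall t, sdp_exact (Q0 + eps t *: P) Q b) :
  sdp_exact Q0 Q b.
Proof.
pose K := sdp_feasible Q b.
pose K1 := K `&` [set X | (\rank X <= 1)%N].
have Kcl : closed K by exact: sdp_feasible_closed.
have Kco : compact K by exact: mx_bounded_closed_compact.
have K1co : compact K1.
  apply: (subclosed_compact _ Kco); last by move=> X [].
  by apply: closedI => //; exact: rank_le1_closed.
(* The perturbation changes only the objective, so a solution of any perturbed relaxation is
   feasible for the original one. *)
have K1nz : K1 !=set0 by have [X [KX _] rX] := eps_exact 0%N; exists X.
have Knz : K !=set0 by have [X [KX _]] := K1nz; exists X.
have inner_cont A (D : set 'M[R]_n) : {within D, continuous (mxinner A)}.
  exact/continuous_subspaceT/mxinner_continuous.
have [X /set_mem[KX rX] Xmin] := compact_EVT_min K1nz K1co (inner_cont Q0 K1).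
(* [Y] provides a lower bound for [P] at all the perturbed solutions that is independent of [t]. *)
have [Y _ Ymin] := compact_EVT_min Knz Kco (inner_cont P K).
exists X => //; split => // Z KZ.
have bound t : mxinner Q0 X <=
    mxinner Q0 Z + eps t * (mxinner P Z - mxinner P Y).
  have [Xt [KXt Xtopt] rXt] := eps_exact t.
  have Q0X : mxinner Q0 X <= mxinner Q0 Xt by apply/Xmin/mem_set.
  (* Scaling by [eps t] beforehand leaves a goal that is linear once the products are taken as
     atoms. *)
  have PY : eps t * mxinner P Y <= eps t * mxinner P Xt.
    by rewrite ler_pM2l//; apply/Ymin/mem_set.
  have := Xtopt _ KZ; rewrite !mxinnerDl !mxinnerZl => XtZ.
  lra.
have bound_cvg : (fun t => mxinner Q0 Z + eps t * (mxinner P Z - mxinner P Y))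
    @ \oo --> mxinner Q0 Z.
  rewrite -[X in _ --> X]addr0 -(mul0r (mxinner P Z - mxinner P Y)).
  apply: cvgD; first exact: cvg_cst.
  by apply: cvgM; [exact: eps_cvg0 | exact: cvg_cst].
by apply: (cvgr_to_ge bound_cvg); exact: nearW.
Qed.
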